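(* Let $c_0>0$, $\alpha_0,\tau_0>0$, $\gamma\in(1,2]$, and $$\alpha^*_{ksb}(\omega)=\frac{\alpha_0(-i\omega)}{c_0\sqrt{1+(-i\tau_0\omega)^{\gamma-1}}},\qquad\omega\in\mathbb{R}.$$ Then $K(\vec x,t)=\frac{1}{\sqrt{2\pi}}\mathcal{F}^{-1}\{e^{-\alpha^*_{ksb}(\cdot)|\vec x|}\}(t)$ is causal.
   Context: Fourier convention: $\mathcal{F}^{-1}\{\hat f\}(t)=\frac{1}{\sqrt{2\pi}}\int_{\mathbb{R}}e^{-i\omega t}\hat f(\omega)\,d\omega$ (tempered distributions). Complex powers are principal branch ($w=re^{i\phi}$, $\phi\in(-\pi,\pi)$, $w^\gamma=e^{\gamma(\log r+i\phi)}$); the square root is the complex root with non-negative real part. $K$ is causal if $t\mapsto K(\vec x,t)$ vanishes for $t<0$ for every $\vec x\in\mathbb{R}^3$. *)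

(* Defs.v *)
From Stdlib Require Import Reals.
From Coquelicot Require Import Coquelicot.
Open Scope R_scope.

Definition Cexp (z : C) : C :=
  (exp (Re z) * cos (Im z), exp (Re z) * sin (Im z)).

(* principal argument phi in (-pi, pi] of w <> 0 *)
Definition Carg (w : C) : R :=
  if Rle_dec 0 (Im w) then acos (Re w / Cmod w) else - acos (Re w / Cmod w).

Definition Cpow (w : C) (g : R) : C :=
  if Ceq_dec w 0 then 0%C else Cexp (g * ln (Cmod w), g * Carg w).

(* complex square root with non-negative real part (principal branch) *)
Definition Csqrt (w : C) : C := Cpow w (1/2).

Definition alpha_ksb (c0 alpha0 tau0 gamma omega : R) : C :=
  ((RtoC alpha0 * (0%R, (- omega)%R)) /
   (RtoC c0 * Csqrt (1 + Cpow (0%R, (- (tau0 * omega))%R) (gamma - 1))))%C.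

Definition Khat (c0 alpha0 tau0 gamma r omega : R) : C :=
  Cexp (- (alpha_ksb c0 alpha0 tau0 gamma omega * RtoC r))%C.

Definition norm3 (x1 x2 x3 : R) : R := sqrt (x1 ^ 2 + x2 ^ 2 + x3 ^ 2).

Definition smooth (phi : R -> R) : Prop := forall n t, ex_derive_n phi n t.

(* F^{-1} of a test function phi supported in [a,b]:
   (F^{-1} phi)(omega) = 1/sqrt(2pi) int e^{-i omega t} phi(t) dt *)
Definition Finv_test (phi : R -> R) (a b omega : R) : C :=
  (RtoC (/ sqrt (2 * PI)) *
   RInt (V := C_R_CompleteNormedModule)
        (fun t => Cexp (0%R, (- (omega * t))%R) * RtoC (phi t)) a b)%C.

(* Main.v *)
Require Import Defs.
From Stdlib Require Import Reals Lra Psatz.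
From Coquelicot Require Import Coquelicot.
Open Scope R_scope.

(* With s = - i omega the attenuation is a multiple of
   h(s) = s (1 + (tau0 s)^(gamma - 1))^(-1/2), which is holomorphic in Re s > 0,
   continuous on Re s >= 0, and satisfies Re h >= 0 there because gamma - 1 <= 1.
   Hence exp(- kappa h) is bounded by 1.  The transform int e^(s t) phi(t) dt of a
   test function supported in t <= b < 0 is O(e^(b Re s) / (1 + |s|)).  By the
   Cauchy-Riemann equations, shifting the segment [A, B] of the line Re s = 0 to
   Re s = x changes the integral of the product by the two horizontal sides, which
   contribute O((1/|A| + 1/B) / |b|), and the shifted integral vanishes as x tends
   to infinity. *)

(** * The principal logarithm *)

(** No contour integral is formed. For F the product of the damping factor and the transform,
    written in real coordinates s = x - i y, the integral of one component of F over y in [A, B] is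
    differentiated in x. Cauchy-Riemann turns the integrand of the derivative into a y-derivative of
    the other component, up to sign, so only values at y = A and y = B remain. One integration by
    parts gives decay 1/|y| there, and the factor e^(b x) with b < 0 makes sides of infinite length
    harmless. The obstacle is s = 0: it lies on the original line, and for gamma < 2 the power (tau0
    s)^(gamma - 1) has no derivative there. Derivatives are therefore used for x > 0 only, and x = 0
    is reached by continuity, with x replaced by max(x, 0) so that continuity can be stated in full
    neighbourhoods of the boundary. The logarithm is given by one real formula on the whole slit
    plane, so that its derivative needs no case distinction on the sign of Im w. *)

(* The half-angle form of the principal argument is smooth on the whole slit plane,
   which is the condition [0 < Cmod w + Re w]; on the slit it takes junk values. *)
Definition Cln (w : C) : C := (ln (Cmod w), 2 * atan (Im w / (Cmod w + Re w))).

Lemma Cmod_sqr (w : C) : Cmod w * Cmod w = Re w * Re w + Im w * Im w.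
Proof. generalize (Cmod2_alt w); simpl; lra. Qed.

Lemma slit_Cmod_gt_0 (w : C) : 0 < Cmod w + Re w -> 0 < Cmod w.
Proof.
  intros H. generalize (re_le_Cmod w) (Rle_abs (Re w)); lra.
Qed.

Lemma slit_neq_0 (w : C) : 0 < Cmod w + Re w -> w <> 0%C.
Proof. intros H. now apply Cmod_gt_0, slit_Cmod_gt_0. Qed.

Lemma slit_halfplane (w : C) : 0 <= Re w -> w <> 0%C -> 0 < Cmod w + Re w.
Proof. intros H Hw. apply Cmod_gt_0 in Hw. lra. Qed.

Lemma atan_pos (t : R) : 0 <= t -> 0 <= atan t.
Proof.
  intros [H|<-]; [|rewrite atan_0; lra].
  rewrite <- atan_0. left. now apply atan_increasing.
Qed.

Lemma cos_double_atan (t : R) : cos (2 * atan t) = (1 - t * t) / (1 + t * t).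
Proof.
  rewrite cos_2a_cos, cos_atan.
  assert (Hs : 0 < sqrt (1 + t²)) by (apply sqrt_lt_R0; unfold Rsqr; nra).
  assert (Hq : sqrt (1 + t²) * sqrt (1 + t²) = 1 + t * t)
    by (apply sqrt_sqrt; unfold Rsqr; nra).
  replace (2 * (1 / sqrt (1 + t²)) * (1 / sqrt (1 + t²)))
    with (2 / (sqrt (1 + t²) * sqrt (1 + t²))) by (field; lra).
  rewrite Hq. field. nra.
Qed.

Lemma sin_double_atan (t : R) : sin (2 * atan t) = 2 * t / (1 + t * t).
Proof.
  rewrite sin_2a, cos_atan, sin_atan.
  assert (Hs : 0 < sqrt (1 + t²)) by (apply sqrt_lt_R0; unfold Rsqr; nra).
  assert (Hq : sqrt (1 + t²) * sqrt (1 + t²) = 1 + t * t)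
    by (apply sqrt_sqrt; unfold Rsqr; nra).
  rewrite <- Hq. field; lra.
Qed.

(** With m = |w| and w = u + i v, the identity v^2 = (m - u)(m + u) gives t^2 = (m - u)/(m + u) for
    t = v/(m + u), and (1 - t^2)/(1 + t^2) is then u/m. *)
Lemma cos_Im_Cln (w : C) : 0 < Cmod w + Re w -> cos (Im (Cln w)) = Re w / Cmod w.
Proof.
  intros H. generalize (slit_Cmod_gt_0 w H) (Cmod_sqr w). unfold Cln; simpl.
  intros Hm Hsq. rewrite cos_double_atan.
  set (m := Cmod w) in *. set (u := Re w) in *. set (v := Im w) in *.
  replace (v / (m + u) * (v / (m + u))) with ((m - u) / (m + u)).
  - field. lra.
  - replace (v / (m + u) * (v / (m + u))) with ((v * v) / ((m + u) * (m + u)))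
      by (field; lra).
    replace (v * v) with ((m - u) * (m + u)) by lra. field; lra.
Qed.

Lemma Cexp_Cln (w : C) : 0 < Cmod w + Re w -> Cexp (Cln w) = w.
Proof.
  intros H. assert (Hm := slit_Cmod_gt_0 w H). assert (Hsq := Cmod_sqr w).
  unfold Cexp. rewrite cos_Im_Cln by assumption.
  replace (exp (Re (Cln w))) with (Cmod w) by (simpl; now rewrite exp_ln).
  replace (sin (Im (Cln w))) with (Im w / Cmod w).
  - apply injective_projections; simpl; unfold Re, Im; field; lra.
  - unfold Cln; simpl. rewrite sin_double_atan.
    set (m := Cmod w) in *. set (u := Re w) in *. set (v := Im w) in *.
    replace (1 + v / (m + u) * (v / (m + u))) with (2 * m / (m + u)).
    + field. lra.
    + replace (1 + v / (m + u) * (v / (m + u)))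
        with (((m + u) * (m + u) + v * v) / ((m + u) * (m + u))) by (field; lra).
      replace ((m + u) * (m + u) + v * v) with (2 * m * (m + u)) by lra.
      field; lra.
Qed.

(** The argument lies strictly between -PI and PI, and its cosine Re w / |w| is non-negative. *)
Lemma Im_Cln_halfplane (w : C) :
  0 < Cmod w + Re w -> 0 <= Re w -> - (PI / 2) <= Im (Cln w) <= PI / 2.
Proof.
  intros Hs Hr. assert (Hm := slit_Cmod_gt_0 w Hs).
  assert (Hc := cos_Im_Cln w Hs).
  assert (0 <= cos (Im (Cln w))).
  { rewrite Hc. apply Rmult_le_pos; [assumption|]. left; now apply Rinv_0_lt_compat. }
  assert (Hb : - PI < Im (Cln w) < PI).
  { unfold Cln; simpl. destruct (atan_bound (Im w / (Cmod w + Re w))). lra. }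
  split; apply Rnot_lt_le; intros Hlt.
  - assert (cos (- Im (Cln w)) < 0) by (apply cos_lt_0; lra). rewrite cos_neg in *. lra.
  - assert (cos (Im (Cln w)) < 0) by (apply cos_lt_0; lra). lra.
Qed.

Lemma sign_Im_Cln (w : C) :
  0 < Cmod w + Re w ->
  (0 <= Im w -> 0 <= Im (Cln w)) /\ (Im w <= 0 -> Im (Cln w) <= 0).
Proof.
  intros Hs. unfold Cln. simpl. assert (Hi := Rinv_0_lt_compat _ Hs). split; intros H.
  - assert (0 <= atan (Im w / (Cmod w + Re w))); [|lra].
    apply atan_pos. apply Rmult_le_pos; lra.
  - assert (0 <= atan (- (Im w / (Cmod w + Re w)))) as Ha.
    { apply atan_pos. unfold Rdiv. rewrite Ropp_mult_distr_l. apply Rmult_le_pos; lra. }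
    rewrite atan_opp in Ha. lra.
Qed.

(** Links the [acos] definition in the statement to the smooth form. Since [acos] inverts [cos] only
    on [0, PI], the sign of Im w decides between the angle and its negative. *)
Lemma Carg_Cln (w : C) : 0 < Cmod w + Re w -> Carg w = Im (Cln w).
Proof.
  intros H. unfold Carg. rewrite <- (cos_Im_Cln w H). unfold Cln; simpl.
  set (t := Im w / (Cmod w + Re w)).
  destruct (atan_bound t) as [Hl Hu].
  destruct (Rle_dec 0 (Im w)) as [Hv|Hv].
  - apply acos_cos. split; [|lra].
    assert (0 <= atan t); [|lra]. apply atan_pos. unfold t.
    apply Rmult_le_pos; [assumption|]. left; now apply Rinv_0_lt_compat.
  - rewrite <- cos_neg, acos_cos; [lra|].
    assert (0 <= atan (- t)) as Hp.
    { apply atan_pos. unfold t.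
      replace (- (Im w / (Cmod w + Re w))) with ((- Im w) / (Cmod w + Re w))
        by (field; lra).
      apply Rmult_le_pos; [lra|]. left; now apply Rinv_0_lt_compat. }
    rewrite atan_opp in Hp. lra.
Qed.

Lemma Cpow_Cln (w : C) (g : R) :
  0 < Cmod w + Re w -> Defs.Cpow w g = Cexp (RtoC g * Cln w)%C.
Proof.
  intros H. unfold Defs.Cpow. destruct (Ceq_dec w 0) as [->|_].
  - exfalso. rewrite Cmod_0 in H. simpl in H. lra.
  - rewrite Carg_Cln by assumption. f_equal.
    apply injective_projections; simpl; ring.
Qed.

(** * The complex exponential *)

Lemma Cexp_Cmod (z : C) : Cmod (Cexp z) = exp (Re z).
Proof.
  unfold Cmod, Cexp; simpl fst; simpl snd.
  replace ((exp (Re z) * cos (Im z)) ^ 2 + (exp (Re z) * sin (Im z)) ^ 2)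
    with (exp (Re z) ^ 2 * ((sin (Im z))² + (cos (Im z))²))
    by (unfold Rsqr; ring).
  rewrite sin2_cos2, Rmult_1_r. rewrite sqrt_pow2; [easy|].
  left; apply exp_pos.
Qed.

Lemma Cexp_neq_0 (z : C) : Cexp z <> 0%C.
Proof. apply Cmod_gt_0. rewrite Cexp_Cmod. apply exp_pos. Qed.

Lemma Cexp_plus (z w : C) : Cexp (z + w)%C = (Cexp z * Cexp w)%C.
Proof.
  apply injective_projections; unfold Cexp, Re, Im; simpl;
    rewrite exp_plus, ?cos_plus, ?sin_plus; ring.
Qed.

Lemma Cexp_0 : Cexp 0%C = 1%C.
Proof.
  unfold Cexp. change (Re 0%C) with 0. change (Im 0%C) with 0.
  now rewrite exp_0, cos_0, sin_0, Rmult_0_r, Rmult_1_r.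
Qed.

Lemma Cexp_opp (z : C) : Cexp (- z)%C = (/ Cexp z)%C.
Proof.
  assert (H : (Cexp z * Cexp (- z))%C = 1%C).
  { rewrite <- Cexp_plus, <- Cexp_0. f_equal. ring. }
  apply (f_equal (fun x => (/ Cexp z * x)%C)) in H.
  rewrite Cmult_assoc, Cinv_l, Cmult_1_l, Cmult_1_r in H; [easy|apply Cexp_neq_0].
Qed.

(** * Complex-valued functions of a real variable *)

Definition cderive (z : R -> C) (t : R) (d : C) : Prop :=
  is_derive (fun t => Re (z t)) t (Re d) /\ is_derive (fun t => Im (z t)) t (Im d).

Lemma cderive_eq (z : R -> C) (t : R) (d d' : C) :
  cderive z t d -> d = d' -> cderive z t d'.
Proof. now intros H <-. Qed.

Lemma cderive_const (c : C) (t : R) : cderive (fun _ => c) t 0%C.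
Proof. split; apply @is_derive_const. Qed.

Lemma cderive_plus (f g : R -> C) (t : R) (df dg : C) :
  cderive f t df -> cderive g t dg ->
  cderive (fun t => f t + g t)%C t (df + dg)%C.
Proof. intros [H1 H2] [H3 H4]; split; apply @is_derive_plus; assumption. Qed.

(** For unknown functions [auto_derive] leaves terms [Derive g t]; these are replaced by the
    derivatives known from the hypotheses. *)
Ltac solve_derive :=
  auto_derive;
  [ repeat split; try (eexists; eassumption)
  | repeat match goal with
    | H : is_derive ?f ?t ?d |- context [Derive ?g ?t] =>
      replace (Derive g t) with d
        by (symmetry; change (Derive f t = d); apply (is_derive_unique f t d H))
    end ].

Lemma cderive_mult (f g : R -> C) (t : R) (df dg : C) :
  cderive f t df -> cderive g t dg ->
  cderive (fun t => f t * g t)%C t (df * g t + f t * dg)%C.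
Proof.
  intros [H1 H2] [H3 H4]. unfold cderive. simpl.
  change (fst df) with (Re df) in *. change (snd df) with (Im df) in *.
  change (fst dg) with (Re dg) in *. change (snd dg) with (Im dg) in *.
  set (f1 := fun t => Re (f t)) in *. set (f2 := fun t => Im (f t)) in *.
  set (g1 := fun t => Re (g t)) in *. set (g2 := fun t => Im (g t)) in *.
  change (fst (f t)) with (f1 t). change (snd (f t)) with (f2 t).
  change (fst (g t)) with (g1 t). change (snd (g t)) with (g2 t).
  split.
  - change (is_derive (fun t => f1 t * g1 t - f2 t * g2 t) t
      (Re df * g1 t - Im df * g2 t + (f1 t * Re dg - f2 t * Im dg))).
    solve_derive. ring.
  - change (is_derive (fun t => f1 t * g2 t + f2 t * g1 t) t
      (Re df * g2 t + Im df * g1 t + (f1 t * Im dg + f2 t * Re dg))).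
    solve_derive. ring.
Qed.

Lemma cderive_Cexp (f : R -> C) (t : R) (df : C) :
  cderive f t df -> cderive (fun t => Cexp (f t)) t (df * Cexp (f t))%C.
Proof.
  intros [H1 H2]. unfold cderive. simpl.
  change (fst df) with (Re df) in *. change (snd df) with (Im df) in *.
  set (f1 := fun t => Re (f t)) in *. set (f2 := fun t => Im (f t)) in *.
  change (Re (f t)) with (f1 t). change (Im (f t)) with (f2 t).
  split.
  - change (is_derive (fun t => exp (f1 t) * cos (f2 t)) t
      (Re df * (exp (f1 t) * cos (f2 t)) - Im df * (exp (f1 t) * sin (f2 t)))).
    solve_derive. ring.
  - change (is_derive (fun t => exp (f1 t) * sin (f2 t)) t
      (Re df * (exp (f1 t) * sin (f2 t)) + Im df * (exp (f1 t) * cos (f2 t)))).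
    solve_derive. ring.
Qed.

Lemma is_derive_ln_modulus (u v : R -> R) (t du dv : R) :
  0 < u t ^ 2 + v t ^ 2 -> is_derive u t du -> is_derive v t dv ->
  is_derive (fun t => ln (sqrt (u t ^ 2 + v t ^ 2))) t
    ((u t * du + v t * dv) / (u t ^ 2 + v t ^ 2)).
Proof.
  intros Hp Hu Hv.
  assert (Hm := sqrt_lt_R0 _ Hp).
  assert (Hsq : sqrt (u t ^ 2 + v t ^ 2) * sqrt (u t ^ 2 + v t ^ 2) = u t ^ 2 + v t ^ 2)
    by (apply sqrt_sqrt; lra).
  solve_derive; try assumption.
  replace (u t * (u t * 1) + v t * (v t * 1)) with (u t ^ 2 + v t ^ 2) by ring.
  set (m := sqrt (u t ^ 2 + v t ^ 2)) in *. rewrite <- Hsq.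
  simpl. field. lra.
Qed.

(** The value is Im (w'/w) for w = u + i v. With m = |w| and t = v/(m + u), the relation m^2 = u^2 +
    v^2 reduces 1 + t^2 to 2 m/(m + u), and the rest is rational algebra. *)
Lemma is_derive_arg (u v : R -> R) (t du dv : R) :
  0 < u t ^ 2 + v t ^ 2 -> 0 < sqrt (u t ^ 2 + v t ^ 2) + u t ->
  is_derive u t du -> is_derive v t dv ->
  is_derive (fun t => 2 * atan (v t / (sqrt (u t ^ 2 + v t ^ 2) + u t))) t
    ((u t * dv - v t * du) / (u t ^ 2 + v t ^ 2)).
Proof.
  intros Hp Hs Hu Hv.
  assert (Hm := sqrt_lt_R0 _ Hp).
  assert (Hsq : sqrt (u t ^ 2 + v t ^ 2) * sqrt (u t ^ 2 + v t ^ 2) = u t ^ 2 + v t ^ 2)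
    by (apply sqrt_sqrt; lra).
  solve_derive; try assumption; try (apply Rgt_not_eq; assumption).
  replace (u t * (u t * 1) + v t * (v t * 1)) with (u t ^ 2 + v t ^ 2) by ring.
  revert Hp Hs Hm Hsq. generalize (u t) (v t). intros x y Hp.
  generalize (sqrt (x ^ 2 + y ^ 2)). intros m Hs Hm Hsq. simpl.
  assert (Hd : 1 + y * / (m + x) * (y * / (m + x) * 1) = 2 * m / (m + x)).
  { replace (1 + y * / (m + x) * (y * / (m + x) * 1))
      with (((m + x) * (m + x) + y * y) / ((m + x) * (m + x))) by (field; lra).
    replace ((m + x) * (m + x) + y * y) with (2 * m * (m + x)) by lra.
    field; lra. }
  rewrite Hd.
  replace (x * (x * 1) + y * (y * 1)) with (m * m) by lra.
  replace (1 * dv * / (m + x) + y * (- (((1 * du * ((1 + 1) * (x * 1))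
    + 1 * dv * ((1 + 1) * (y * 1))) * / (2 * m) + 1 * du)) * / ((m + x) * (m + x))))
    with ((x * dv - y * du) / (m * (m + x))).
  - field. lra.
  - apply (Rmult_eq_reg_r (m * (m + x) * (m + x))).
    + replace ((x * dv - y * du) / (m * (m + x)) * (m * (m + x) * (m + x)))
        with ((x * dv - y * du) * (m + x)) by (field; lra).
      match goal with |- _ = ?e => replace e with
        (m * (m + x) * dv - y * (x + m) * du - y * y * dv) by (field; lra) end.
      replace (y * y) with ((m - x) * (m + x)) by lra. ring.
    + apply Rgt_not_eq. repeat apply Rmult_lt_0_compat; assumption.
Qed.

Lemma cderive_Cln (f : R -> C) (t : R) (df : C) :
  0 < Cmod (f t) + Re (f t) ->
  cderive f t df -> cderive (fun t => Cln (f t)) t (df * / f t)%C.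
Proof.
  intros Hs [H1 H2].
  assert (Hm := slit_Cmod_gt_0 _ Hs).
  assert (Hsq := Cmod_sqr (f t)).
  assert (Hp : 0 < Re (f t) ^ 2 + Im (f t) ^ 2) by nra.
  assert (Hp' : Re (f t) ^ 2 + Im (f t) ^ 2 <> 0) by now apply Rgt_not_eq.
  split.
  - replace (Re (df * / f t)%C) with
      ((Re (f t) * Re df + Im (f t) * Im df) / (Re (f t) ^ 2 + Im (f t) ^ 2)).
    + exact (is_derive_ln_modulus (fun t => Re (f t)) (fun t => Im (f t)) t _ _ Hp H1 H2).
    + unfold Re, Im in *. simpl in *. field. apply Rgt_not_eq; lra.
  - replace (Im (df * / f t)%C) with
      ((Re (f t) * Im df - Im (f t) * Re df) / (Re (f t) ^ 2 + Im (f t) ^ 2)).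
    + exact (is_derive_arg (fun t => Re (f t)) (fun t => Im (f t)) t _ _ Hp Hs H1 H2).
    + unfold Re, Im in *. simpl in *. field. apply Rgt_not_eq; lra.
Qed.

(** * Holomorphic functions and the attenuation *)

Definition ccont (f : R -> R -> C) (x y : R) : Prop :=
  continuity_2d_pt (fun x y => Re (f x y)) x y /\
  continuity_2d_pt (fun x y => Im (f x y)) x y.

Lemma ccont_const (c : C) (x y : R) : ccont (fun _ _ => c) x y.
Proof. split; apply continuity_2d_pt_const. Qed.

Lemma ccont_plus (f g : R -> R -> C) (x y : R) :
  ccont f x y -> ccont g x y -> ccont (fun x y => f x y + g x y)%C x y.
Proof. intros [H1 H2] [H3 H4]; split; now apply continuity_2d_pt_plus. Qed.

Lemma ccont_mult (f g : R -> R -> C) (x y : R) :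
  ccont f x y -> ccont g x y -> ccont (fun x y => f x y * g x y)%C x y.
Proof.
  intros [H1 H2] [H3 H4]; split.
  - apply continuity_2d_pt_minus; now apply continuity_2d_pt_mult.
  - apply continuity_2d_pt_plus; now apply continuity_2d_pt_mult.
Qed.

Lemma ccont_Cexp (f : R -> R -> C) (x y : R) :
  ccont f x y -> ccont (fun x y => Cexp (f x y)) x y.
Proof.
  intros [H1 H2]; split; apply continuity_2d_pt_mult; apply continuity_1d_2d_pt_comp;
    try assumption; [reg|apply continuity_cos|reg|apply continuity_sin].
Qed.

Lemma continuity_2d_pt_modulus_sqr (f : R -> R -> C) (x y : R) :
  ccont f x y -> continuity_2d_pt (fun x y => fst (f x y) ^ 2 + snd (f x y) ^ 2) x y.
Proof.
  intros [H1 H2].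
  apply continuity_2d_pt_plus; apply (continuity_1d_2d_pt_comp (fun t => t ^ 2));
    try assumption; reg.
Qed.

Lemma ccont_Cinv (f : R -> R -> C) (x y : R) :
  ccont f x y -> f x y <> 0%C -> ccont (fun x y => / f x y)%C x y.
Proof.
  intros H Hn.
  assert (Hi : continuity_2d_pt (fun x y => / (fst (f x y) ^ 2 + snd (f x y) ^ 2)) x y).
  { apply continuity_2d_pt_inv; [now apply continuity_2d_pt_modulus_sqr|].
    intros E. apply Hn, Cmod_eq_0. unfold Cmod. now rewrite E, sqrt_0. }
  destruct H as [H1 H2].
  split; apply continuity_2d_pt_mult; try assumption.
  now apply continuity_2d_pt_opp.
Qed.

Lemma continuity_2d_pt_Cmod (f : R -> R -> C) (x y : R) :
  ccont f x y -> continuity_2d_pt (fun x y => Cmod (f x y)) x y.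
Proof.
  intros H. apply (continuity_1d_2d_pt_comp sqrt).
  - apply continuity_pt_sqrt. nra.
  - now apply continuity_2d_pt_modulus_sqr.
Qed.

Lemma ccont_Cln (f : R -> R -> C) (x y : R) :
  0 < Cmod (f x y) + Re (f x y) -> ccont f x y -> ccont (fun x y => Cln (f x y)) x y.
Proof.
  intros Hs H. assert (Hm := slit_Cmod_gt_0 _ Hs).
  assert (Hc := continuity_2d_pt_Cmod _ _ _ H).
  destruct H as [H1 H2]. split.
  - apply (continuity_1d_2d_pt_comp ln); [|assumption].
    apply derivable_continuous_pt. exists (/ Cmod (f x y)). now apply derivable_pt_lim_ln.
  - apply (continuity_1d_2d_pt_comp (fun t => 2 * atan t)).
    + reg. apply derivable_continuous_pt, derivable_pt_atan.
    + apply continuity_2d_pt_mult; [assumption|].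
      apply continuity_2d_pt_inv; [|now apply Rgt_not_eq].
      now apply continuity_2d_pt_plus.
Qed.

(* The complex variable is s = x - i y, so that the boundary point (0, omega)
   stands for - i omega and the y-derivative of f is - i f'. *)
Definition holomorphic (D : R -> R -> Prop) (f f' : R -> R -> C) : Prop :=
  forall x y, D x y ->
    cderive (fun t => f t y) x (f' x y) /\
    cderive (fun t => f x t) y (- Ci * f' x y)%C /\
    ccont f x y /\ ccont f' x y.

Definition svar (x y : R) : C := (x, - y).

Lemma ccont_svar (x y : R) : ccont svar x y.
Proof.
  split; [apply continuity_2d_pt_id1|].
  apply continuity_2d_pt_opp, continuity_2d_pt_id2.
Qed.

Lemma holomorphic_svar (D : R -> R -> Prop) : holomorphic D svar (fun _ _ => 1%C).
Proof.
  intros x y _. split; [|split; [|split]].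
  - split; simpl; auto_derive; easy.
  - split; simpl; auto_derive; trivial; ring.
  - apply ccont_svar.
  - apply ccont_const.
Qed.

Lemma holomorphic_const (D : R -> R -> Prop) (c : C) :
  holomorphic D (fun _ _ => c) (fun _ _ => 0%C).
Proof.
  intros x y _. split; [|split; [|split]]; try apply ccont_const.
  - apply cderive_const.
  - eapply cderive_eq; [apply cderive_const|ring].
Qed.

Lemma holomorphic_plus (D : R -> R -> Prop) (f f' g g' : R -> R -> C) :
  holomorphic D f f' -> holomorphic D g g' ->
  holomorphic D (fun x y => f x y + g x y)%C (fun x y => f' x y + g' x y)%C.
Proof.
  intros Hf Hg x y HD. destruct (Hf x y HD) as (A1 & A2 & A3 & A4).
  destruct (Hg x y HD) as (B1 & B2 & B3 & B4).
  split; [|split; [|split]]; try now apply ccont_plus.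
  - now apply (cderive_plus (fun t => f t y) (fun t => g t y)).
  - eapply cderive_eq;
      [now apply (cderive_plus (fun t => f x t) (fun t => g x t)); eassumption|ring].
Qed.

Lemma holomorphic_mult (D : R -> R -> Prop) (f f' g g' : R -> R -> C) :
  holomorphic D f f' -> holomorphic D g g' ->
  holomorphic D (fun x y => f x y * g x y)%C
    (fun x y => f' x y * g x y + f x y * g' x y)%C.
Proof.
  intros Hf Hg x y HD. destruct (Hf x y HD) as (A1 & A2 & A3 & A4).
  destruct (Hg x y HD) as (B1 & B2 & B3 & B4).
  split; [|split; [|split]].
  - now apply (cderive_mult (fun t => f t y) (fun t => g t y)).
  - eapply cderive_eq;
      [apply (cderive_mult (fun t => f x t) (fun t => g x t)); eassumption|ring].
  - now apply ccont_mult.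
  - apply ccont_plus; now apply ccont_mult.
Qed.

Lemma holomorphic_Cexp (D : R -> R -> Prop) (f f' : R -> R -> C) :
  holomorphic D f f' ->
  holomorphic D (fun x y => Cexp (f x y)) (fun x y => f' x y * Cexp (f x y))%C.
Proof.
  intros Hf x y HD. destruct (Hf x y HD) as (A1 & A2 & A3 & A4).
  split; [|split; [|split]].
  - now apply (cderive_Cexp (fun t => f t y)).
  - eapply cderive_eq; [apply (cderive_Cexp (fun t => f x t)); eassumption|ring].
  - now apply ccont_Cexp.
  - apply ccont_mult; [assumption|now apply ccont_Cexp].
Qed.

Lemma holomorphic_Cln (D : R -> R -> Prop) (f f' : R -> R -> C) :
  (forall x y, D x y -> 0 < Cmod (f x y) + Re (f x y)) ->
  holomorphic D f f' ->
  holomorphic D (fun x y => Cln (f x y)) (fun x y => f' x y * / f x y)%C.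
Proof.
  intros Hs Hf x y HD. destruct (Hf x y HD) as (A1 & A2 & A3 & A4).
  specialize (Hs x y HD).
  split; [|split; [|split]].
  - now apply (cderive_Cln (fun t => f t y)).
  - eapply cderive_eq; [apply (cderive_Cln (fun t => f x t)); eassumption|ring].
  - now apply ccont_Cln.
  - apply ccont_mult; [assumption|apply ccont_Cinv; [assumption|now apply slit_neq_0]].
Qed.

(** * The attenuation on the closed right half-plane *)

Definition punctured_halfplane (x y : R) : Prop := 0 <= x /\ svar x y <> 0%C.

(** The principal power (tau s)^beta, where beta stands for gamma - 1. Its value at s = 0 is junk,
    which the factor s of [attenuation] removes. *)
Definition relaxation (tau beta : R) (x y : R) : C :=
  Cexp (RtoC beta * Cln (RtoC tau * svar x y))%C.

Definition attenuation (tau beta : R) (x y : R) : C :=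
  (svar x y * Cexp (RtoC (- (1 / 2)) * Cln (1 + relaxation tau beta x y)))%C.

Section Attenuation.

Variables (tau beta : R).
Hypothesis (Htau : 0 < tau) (Hbeta0 : 0 < beta) (Hbeta1 : beta <= 1).

Lemma slit_scaled_svar (x y : R) :
  punctured_halfplane x y ->
  0 < Cmod (RtoC tau * svar x y)%C + Re (RtoC tau * svar x y)%C.
Proof.
  intros [Hx Hs]. apply slit_halfplane.
  - simpl. nra.
  - apply Cmult_neq_0; [|assumption]. intros E. apply (f_equal fst) in E. simpl in E. lra.
Qed.

(** The argument of (tau s)^beta is beta arg s, of modulus at most PI/2 because |arg s| <= PI/2 and
    beta <= 1. Hence 1 + (tau s)^beta has real part at least 1 and avoids the slit. *)
Lemma Re_relaxation_ge_0 (x y : R) :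
  punctured_halfplane x y -> 0 <= Re (relaxation tau beta x y).
Proof.
  intros HD. assert (Hs := slit_scaled_svar x y HD).
  destruct HD as [Hx _].
  assert (Hb := Im_Cln_halfplane _ Hs).
  destruct Hb as [Hl Hu]; [simpl; nra|].
  unfold relaxation.
  apply Rmult_le_pos; [left; apply exp_pos|].
  replace (Im (RtoC beta * Cln (RtoC tau * svar x y))%C)
    with (beta * Im (Cln (RtoC tau * svar x y))%C) by (unfold Im; simpl; ring).
  apply cos_ge_0; nra.
Qed.

Lemma slit_one_plus_relaxation (x y : R) :
  punctured_halfplane x y ->
  0 < Cmod (1 + relaxation tau beta x y)%C + Re (1 + relaxation tau beta x y)%C.
Proof.
  intros HD. assert (H := Re_relaxation_ge_0 x y HD).
  assert (Cmod (1 + relaxation tau beta x y)%C >= 0) by (apply Rle_ge, Cmod_ge_0).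
  assert (Re (1 + relaxation tau beta x y)%C = 1 + Re (relaxation tau beta x y)) by easy.
  lra.
Qed.

Lemma attenuation_holomorphic :
  exists h', holomorphic punctured_halfplane (attenuation tau beta) h'.
Proof.
  eexists. unfold attenuation. apply holomorphic_mult; [apply holomorphic_svar|].
  apply holomorphic_Cexp, holomorphic_mult; [apply holomorphic_const|].
  apply holomorphic_Cln; [exact slit_one_plus_relaxation|].
  apply holomorphic_plus; [apply holomorphic_const|].
  apply holomorphic_Cexp, holomorphic_mult; [apply holomorphic_const|].
  apply holomorphic_Cln; [exact slit_scaled_svar|].
  apply holomorphic_mult; [apply holomorphic_const|apply holomorphic_svar].
Qed.

(** Since |1 + (tau s)^beta| >= 1, the inverse square root has modulus at most 1. This controls the
    attenuation at the branch point. *)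
Lemma Cmod_attenuation_le (x y : R) :
  0 <= x -> Cmod (attenuation tau beta x y) <= Cmod (svar x y).
Proof.
  intros Hx. unfold attenuation. rewrite Cmod_mult, Cexp_Cmod.
  destruct (Ceq_dec (svar x y) 0) as [->|Hs].
  { rewrite Cmod_0. lra. }
  assert (Hr := Re_relaxation_ge_0 x y (conj Hx Hs)).
  rewrite <- (Rmult_1_r (Cmod (svar x y))) at 2.
  apply Rmult_le_compat_l; [apply Cmod_ge_0|].
  apply Rle_trans with (exp 0); [|rewrite exp_0; apply Rle_refl].
  assert (Hl : 0 <= ln (Cmod (1 + relaxation tau beta x y))).
  { rewrite <- ln_1. apply Rcomplements.ln_le; [lra|].
    apply Rle_trans with (2 := re_le_Cmod _).
    apply Rle_trans with (2 := Rle_abs _).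
    change (1 <= 1 + Re (relaxation tau beta x y)). lra. }
  set (e := Re _).
  assert (He : e = - (1 / 2) * ln (Cmod (1 + relaxation tau beta x y)))
    by (unfold e, Cln, Re, Rdiv; cbn [fst snd RtoC Cmult]; ring).
  assert (Hn : e <= 0) by lra.
  destruct Hn as [Hn| ->]; [left; now apply exp_increasing|lra].
Qed.

(* If theta = arg s then the argument psi of 1 + (tau s)^beta has the sign of
   theta and modulus at most pi/2, hence |theta - psi/2| <= pi/2. *)
Lemma Re_attenuation_ge_0 (x y : R) :
  0 <= x -> 0 <= Re (attenuation tau beta x y).
Proof.
  intros Hx. destruct (Ceq_dec (svar x y) 0) as [E|Hs].
  { unfold attenuation. rewrite E, Cmult_0_l. apply Rle_refl. }
  assert (HD : punctured_halfplane x y) by (split; assumption).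
  assert (S1 := slit_scaled_svar x y HD).
  assert (S2 := slit_one_plus_relaxation x y HD).
  assert (R1 := Re_relaxation_ge_0 x y HD).
  assert (B1 : 0 <= Re (RtoC tau * svar x y)%C) by (simpl; nra).
  assert (B2 : 0 <= Re (1 + relaxation tau beta x y)%C)
    by (change (0 <= 1 + Re (relaxation tau beta x y)); lra).
  apply (Im_Cln_halfplane _ S1) in B1. apply (Im_Cln_halfplane _ S2) in B2.
  (* Scaling by tau > 0 keeps the sign of the real part and lets s enter through the same logarithm
     of tau s that defines [relaxation]. *)
  assert (E : (RtoC tau * attenuation tau beta x y)%C =
    Cexp (Cln (RtoC tau * svar x y)
          + RtoC (- (1 / 2)) * Cln (1 + relaxation tau beta x y))%C).
  { unfold attenuation. rewrite Cexp_plus, Cexp_Cln by assumption. ring. }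
  apply (f_equal Re) in E.
  assert (E1 : Re (RtoC tau * attenuation tau beta x y)%C
    = tau * Re (attenuation tau beta x y)) by (simpl; unfold Re; ring).
  rewrite E1 in E. apply (Rmult_le_reg_l tau); [assumption|]. rewrite Rmult_0_r, E.
  apply Rmult_le_pos; [left; apply exp_pos|].
  set (th := Im (Cln (RtoC tau * svar x y))) in *.
  set (ps := Im (Cln (1 + relaxation tau beta x y))) in *.
  match goal with |- 0 <= cos ?e => replace e with (th - ps / 2) end.
  2: { unfold th, ps. unfold Im. simpl. field. }
  assert (E2 : Im (relaxation tau beta x y) =
    exp (Re (RtoC beta * Cln (RtoC tau * svar x y))%C) * sin (beta * th)).
  { replace (beta * th) with (Im (RtoC beta * Cln (RtoC tau * svar x y))%C)
      by (unfold th, Im; simpl; ring).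
    reflexivity. }
  assert (E3 : Im (1 + relaxation tau beta x y)%C = Im (relaxation tau beta x y))
    by (unfold Im; simpl; ring).
  destruct (sign_Im_Cln _ S2) as [P1 P2]. fold ps in P1, P2. rewrite E3, E2 in P1, P2.
  assert (He := exp_pos (Re (RtoC beta * Cln (RtoC tau * svar x y))%C)).
  assert (HPI := PI_RGT_0).
  destruct (Rle_dec 0 th) as [Hth|Hth].
  - assert (0 <= ps).
    { apply P1, Rmult_le_pos; [lra|]. apply sin_ge_0; nra. }
    apply cos_ge_0; lra.
  - assert (ps <= 0).
    { apply P2. assert (0 <= sin (- (beta * th))) as Hn by (apply sin_ge_0; nra).
      rewrite sin_neg in Hn. nra. }
    apply cos_ge_0; lra.
Qed.

End Attenuation.

(** * Laplace transforms of test functions *)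

Lemma RInt_ext_R (f g : R -> R) (a b : R) :
  (forall t, f t = g t) -> RInt f a b = RInt g a b.
Proof. intros H. apply RInt_ext. intros; apply H. Qed.

Lemma is_derive_RInt_kernel (k k' : R -> R -> R) (psi : R -> R) (a b u0 : R) :
  (forall u t, is_derive (fun u => k u t) u (k' u t)) ->
  (forall u t, continuity_2d_pt k' u t) ->
  (forall u t, continuous (k u) t) ->
  (forall t, continuous psi t) ->
  is_derive (fun u => RInt (fun t => k u t * psi t) a b) u0
    (RInt (fun t => k' u0 t * psi t) a b).
Proof.
  intros Hd Hc Hk Hpsi.
  assert (Hd' : forall u t, is_derive (fun u => k u t * psi t) u (k' u t * psi t)).
  { intros u t. auto_derive; [eexists; apply Hd|].
    rewrite (is_derive_unique (fun u : R => k u t) u _ (Hd u t)). ring. }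
  replace (RInt (fun t => k' u0 t * psi t) a b)
    with (RInt (fun t => Derive (fun u => k u t * psi t) u0) a b).
  2: { apply RInt_ext. intros t _. apply is_derive_unique, Hd'. }
  apply is_derive_RInt_param.
  - apply filter_forall. intros u t _. eexists. apply Hd'.
  - intros t _. apply continuity_2d_pt_ext with (fun u v => k' u v * psi v).
    + intros u v. symmetry. apply is_derive_unique, Hd'.
    + apply continuity_2d_pt_mult; [apply Hc|].
      apply (continuity_1d_2d_pt_comp psi (fun _ v => v)).
      * apply continuity_pt_filterlim, Hpsi.
      * apply continuity_2d_pt_id2.
  - apply filter_forall. intros u.
    apply (ex_RInt_continuous (V := R_CompleteNormedModule)). intros t _.
    apply (continuous_mult (K := R_AbsRing) (k u) psi); [apply Hk|apply Hpsi].
Qed.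

(** Real and imaginary parts of the integral of e^(s t) psi(t) with s = x - i y; at x = 0 this is
    [Finv_test] without its constant. *)
Definition laplace (psi : R -> R) (a b x y : R) : C :=
  (RInt (fun t => exp (x * t) * cos (y * t) * psi t) a b,
   RInt (fun t => - (exp (x * t) * sin (y * t)) * psi t) a b).


Lemma continuous_laplace_kernel (x y t : R) :
  continuous (fun t => exp (x * t) * cos (y * t)) t /\
  continuous (fun t => - (exp (x * t) * sin (y * t))) t.
Proof. split; apply continuity_pt_filterlim; reg. Qed.

Ltac solve_cont2 :=
  repeat first
    [ apply continuity_2d_pt_id1 | apply continuity_2d_pt_id2
    | apply continuity_2d_pt_const
    | apply continuity_2d_pt_mult | apply continuity_2d_pt_opp
    | apply (continuity_1d_2d_pt_comp exp); [reg|]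
    | apply (continuity_1d_2d_pt_comp cos); [apply continuity_cos|]
    | apply (continuity_1d_2d_pt_comp sin); [apply continuity_sin|] ].

(** Differentiating the transform in s multiplies the test function by t. *)
Definition times_id (psi : R -> R) (t : R) : R := t * psi t.

Lemma continuous_times_id (psi : R -> R) :
  (forall t, continuous psi t) -> forall t, continuous (times_id psi) t.
Proof.
  intros H t. apply (continuous_mult (K := R_AbsRing)); [apply continuous_id|apply H].
Qed.

Lemma Re_mult_opp_Ci (w : C) : Re (- Ci * w)%C = Im w.
Proof. unfold Re, Im; simpl; ring. Qed.

Lemma Im_mult_opp_Ci (w : C) : Im (- Ci * w)%C = - Re w.
Proof. unfold Re, Im; simpl; ring. Qed.

Section Laplace.

Variables (psi : R -> R) (a b : R).
Hypothesis (Hpsi : forall t, continuous psi t).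

Lemma ex_RInt_laplace (x y : R) :
  ex_RInt (fun t => exp (x * t) * cos (y * t) * psi t) a b /\
  ex_RInt (fun t => - (exp (x * t) * sin (y * t)) * psi t) a b.
Proof.
  split; apply (ex_RInt_continuous (V := R_CompleteNormedModule)); intros t _;
    apply (continuous_mult (K := R_AbsRing) _ psi); try apply Hpsi;
    apply (continuous_laplace_kernel x y t).
Qed.

Lemma cderive_laplace_re (x y : R) :
  cderive (fun x => laplace psi a b x y) x (laplace (times_id psi) a b x y).
Proof.
  split.
  - replace (Re (laplace (times_id psi) a b x y))
      with (RInt (fun t => (t * exp (x * t) * cos (y * t)) * psi t) a b)
      by (apply RInt_ext_R; intros; unfold times_id; ring).
    apply (is_derive_RInt_kernel (fun x t => exp (x * t) * cos (y * t))
             (fun x t => t * exp (x * t) * cos (y * t))).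
    + intros u t. auto_derive; trivial. ring.
    + intros u t. solve_cont2.
    + intros u t. apply continuous_laplace_kernel.
    + exact Hpsi.
  - replace (Im (laplace (times_id psi) a b x y))
      with (RInt (fun t => - (t * exp (x * t) * sin (y * t)) * psi t) a b)
      by (apply RInt_ext_R; intros; unfold times_id; ring).
    apply (is_derive_RInt_kernel (fun x t => - (exp (x * t) * sin (y * t)))
             (fun x t => - (t * exp (x * t) * sin (y * t)))).
    + intros u t. auto_derive; trivial. ring.
    + intros u t. solve_cont2.
    + intros u t. apply continuous_laplace_kernel.
    + exact Hpsi.
Qed.

Lemma cderive_laplace_im (x y : R) :
  cderive (fun y => laplace psi a b x y) y
    (- Ci * laplace (times_id psi) a b x y)%C.
Proof.
  split.
  - replace (Re (- Ci * laplace (times_id psi) a b x y)%C)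
      with (RInt (fun t => - (t * exp (x * t) * sin (y * t)) * psi t) a b).
    2: { transitivity (Im (laplace (times_id psi) a b x y));
           [apply RInt_ext_R; intros; unfold times_id; ring|symmetry; apply Re_mult_opp_Ci]. }
    apply (is_derive_RInt_kernel (fun y t => exp (x * t) * cos (y * t))
             (fun y t => - (t * exp (x * t) * sin (y * t)))).
    + intros u t. auto_derive; trivial. ring.
    + intros u t. solve_cont2.
    + intros u t. apply continuous_laplace_kernel.
    + exact Hpsi.
  - replace (Im (- Ci * laplace (times_id psi) a b x y)%C)
      with (RInt (fun t => - (t * exp (x * t) * cos (y * t)) * psi t) a b).
    2: { transitivity (- Re (laplace (times_id psi) a b x y));
           [|symmetry; apply Im_mult_opp_Ci].
         unfold laplace, Re; simpl.
         assert (Hex : ex_RInt (fun t => exp (x * t) * cos (y * t) * times_id psi t) a b).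
         { apply (ex_RInt_continuous (V := R_CompleteNormedModule)). intros t _.
           apply (continuous_mult (K := R_AbsRing)); [apply continuous_laplace_kernel|].
           now apply continuous_times_id. }
         etransitivity; [|exact (RInt_opp (V := R_CompleteNormedModule) _ _ _ Hex)].
         apply RInt_ext_R. intros t.
         change (- (t * exp (x * t) * cos (y * t)) * psi t
                 = - (exp (x * t) * cos (y * t) * (t * psi t))).
         ring. }
    apply (is_derive_RInt_kernel (fun y t => - (exp (x * t) * sin (y * t)))
             (fun y t => - (t * exp (x * t) * cos (y * t)))).
    + intros u t. auto_derive; trivial. ring.
    + intros u t. solve_cont2.
    + intros u t. apply continuous_laplace_kernel.
    + exact Hpsi.
Qed.

Lemma laplace_bound (x y M : R) :
  a <= b -> (forall t, a <= t <= b -> exp (x * t) * Rabs (psi t) <= M) ->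
  Rabs (Re (laplace psi a b x y)) <= (b - a) * M /\
  Rabs (Im (laplace psi a b x y)) <= (b - a) * M.
Proof.
  intros Hab HM. destruct (ex_RInt_laplace x y) as [E1 E2].
  split; apply abs_RInt_le_const; try assumption; intros t Ht;
    rewrite !Rabs_mult, ?Rabs_Ropp, ?Rabs_mult, (Rabs_pos_eq (exp _)) by (left; apply exp_pos);
    apply Rle_trans with (2 := HM t Ht);
    assert (He := exp_pos (x * t)); assert (Hp := Rabs_pos (psi t)).
  - assert (Rabs (cos (y * t)) <= 1) by (apply Rabs_le, COS_bound).
    replace (exp (x * t) * Rabs (psi t)) with (exp (x * t) * 1 * Rabs (psi t)) by ring.
    apply Rmult_le_compat_r; [assumption|]. apply Rmult_le_compat_l; lra.
  - assert (Rabs (sin (y * t)) <= 1) by (apply Rabs_le, SIN_bound).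
    replace (exp (x * t) * Rabs (psi t)) with (exp (x * t) * 1 * Rabs (psi t)) by ring.
    apply Rmult_le_compat_r; [assumption|]. apply Rmult_le_compat_l; lra.
Qed.

Lemma continuous_bounded_segment :
  a <= b -> exists M, 0 <= M /\ forall t, a <= t <= b -> Rabs (psi t) <= M.
Proof.
  intros Hab.
  destruct (continuity_ab_maj (fun t => Rabs (psi t)) a b Hab) as [m [Hm _]].
  - intros c _. apply continuity_pt_filterlim.
    apply (continuous_comp psi Rabs); [apply Hpsi|apply continuous_Rabs].
  - exists (Rabs (psi m)). split; [apply Rabs_pos|assumption].
Qed.

End Laplace.

(** The mean value inequality is applied along the path (x, y), (x, v), (u, v), one variable at a
    time. *)
Lemma continuity_2d_pt_bounded_partials (f f1 f2 : R -> R -> R) (x y M : R) :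
  (forall u v, Rabs (u - x) < 1 ->
     is_derive (fun z => f z v) u (f1 u v) /\ Rabs (f1 u v) <= M /\
     is_derive (fun z => f u z) v (f2 u v) /\ Rabs (f2 u v) <= M) ->
  continuity_2d_pt f x y.
Proof.
  intros H eps.
  assert (HM : 0 <= M).
  { destruct (H x y) as (_ & H1 & _); [rewrite Rminus_diag, Rabs_R0; lra|].
    generalize (Rabs_pos (f1 x y)); lra. }
  (* The 1 keeps u where the partials are controlled. With e = eps/(2 (M + 1)) the two moves cost at
     most 2 M e < eps, also when M = 0. *)
  assert (Hd : 0 < Rmin 1 (eps / (2 * (M + 1)))).
  { apply Rmin_glb_lt; [lra|]. apply Rdiv_lt_0_compat; [apply cond_pos|lra]. }
  exists (mkposreal _ Hd). simpl. intros u v Hu Hv.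
  assert (Hu1 := Rlt_le_trans _ _ _ Hu (Rmin_l _ _)).
  assert (Hu2 := Rlt_le_trans _ _ _ Hu (Rmin_r _ _)).
  assert (Hv2 := Rlt_le_trans _ _ _ Hv (Rmin_r _ _)).
  assert (A : Rabs (f u v - f x v) <= M * Rabs (u - x)).
  { apply (bounded_variation (fun z => f z v) (fun z => f1 z v)).
    intros t Ht. destruct (H t v) as (H1 & H2 & _); [lra|]. now split. }
  assert (B : Rabs (f x v - f x y) <= M * Rabs (v - y)).
  { apply (bounded_variation (fun z => f x z) (fun z => f2 x z)).
    intros t Ht. destruct (H x t) as (_ & _ & H1 & H2); [rewrite Rminus_diag, Rabs_R0; lra|].
    now split. }
  replace (f u v - f x y) with ((f u v - f x v) + (f x v - f x y)) by ring.
  apply Rle_lt_trans with (1 := Rabs_triang _ _).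
  set (e := eps / (2 * (M + 1))) in *.
  assert (He : eps = 2 * (M + 1) * e :> R) by (unfold e; field; lra).
  rewrite He. assert (0 < e) by (unfold e; apply Rdiv_lt_0_compat; [apply cond_pos|lra]).
  assert (M * Rabs (u - x) <= M * e) by (apply Rmult_le_compat_l; lra).
  assert (M * Rabs (v - y) <= M * e) by (apply Rmult_le_compat_l; lra).
  lra.
Qed.

(** Both partials are, up to the factor -i, the transform of t psi(t), which is bounded on the strip
    |u - x| < 1 uniformly in v because [a, b] is compact. *)
Lemma ccont_laplace (psi : R -> R) (a b x y : R) :
  (forall t, continuous psi t) -> a <= b -> b < 0 -> 0 <= x ->
  ccont (laplace psi a b) x y.
Proof.
  intros Hpsi Hab Hb Hx.
  assert (Hpsi' : forall t, continuous (times_id psi) t).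
  { now apply continuous_times_id. }
  destruct (continuous_bounded_segment _ _ _ Hpsi' Hab) as (M & HM0 & HM).
  assert (Hbd : forall u v, Rabs (u - x) < 1 ->
    Rabs (Re (laplace (times_id psi) a b u v)) <= (b - a) * (exp (- a) * M) /\
    Rabs (Im (laplace (times_id psi) a b u v)) <= (b - a) * (exp (- a) * M)).
  { intros u v Hu. apply laplace_bound; try assumption. intros t Ht.
    apply Rabs_def2 in Hu.
    apply Rmult_le_compat; [left; apply exp_pos|apply Rabs_pos| |now apply HM].
    (* The strip reaches slightly left of the half-plane, but u > -1 and t < 0 give u t <= -t <=
       -a. *)
    assert (Hut : u * t <= - a) by nra.
    destruct Hut as [Hut| ->]; [left; now apply exp_increasing|lra]. }
  split.
  - apply (continuity_2d_pt_bounded_partials _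
      (fun u v => Re (laplace (times_id psi) a b u v))
      (fun u v => Re (- Ci * laplace (times_id psi) a b u v)%C) x y
      ((b - a) * (exp (- a) * M))).
    intros u v Hu. destruct (Hbd u v Hu) as [B1 B2].
    split; [apply (cderive_laplace_re psi a b Hpsi u v)|].
    split; [assumption|].
    split; [apply (cderive_laplace_im psi a b Hpsi u v)|].
    now rewrite Re_mult_opp_Ci.
  - apply (continuity_2d_pt_bounded_partials _
      (fun u v => Im (laplace (times_id psi) a b u v))
      (fun u v => Im (- Ci * laplace (times_id psi) a b u v)%C) x y
      ((b - a) * (exp (- a) * M))).
    intros u v Hu. destruct (Hbd u v Hu) as [B1 B2].
    split; [apply (cderive_laplace_re psi a b Hpsi u v)|].
    split; [assumption|].
    split; [apply (cderive_laplace_im psi a b Hpsi u v)|].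
    now rewrite Im_mult_opp_Ci, Rabs_Ropp.
Qed.

Lemma holomorphic_laplace (psi : R -> R) (a b : R) :
  (forall t, continuous psi t) -> a <= b -> b < 0 ->
  holomorphic (fun x _ => 0 <= x) (laplace psi a b) (laplace (times_id psi) a b).
Proof.
  intros Hpsi Hab Hb x y Hx. split; [|split; [|split]].
  - now apply (cderive_laplace_re psi a b Hpsi x y).
  - now apply (cderive_laplace_im psi a b Hpsi x y).
  - now apply ccont_laplace.
  - apply ccont_laplace; try assumption. now apply continuous_times_id.
Qed.

(** Integration by parts without boundary terms; this is the source of the decay of the transform in
    |s|. *)
Lemma laplace_derive (psi dpsi : R -> R) (a b x y : R) :
  (forall t, is_derive psi t (dpsi t)) -> (forall t, continuous dpsi t) ->
  psi a = 0 -> psi b = 0 ->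
  (svar x y * laplace psi a b x y = - laplace dpsi a b x y)%C.
Proof.
  intros Hd Hc Ha Hb.
  assert (Hpsi : forall t, continuous psi t).
  { intros t. apply (ex_derive_continuous psi). eexists; apply Hd. }
  destruct (ex_RInt_laplace psi a b Hpsi x y) as [E1 E2].
  destruct (ex_RInt_laplace dpsi a b Hc x y) as [F1 F2].
  assert (G : forall k k' : R -> R, (forall t, is_derive k t (k' t)) ->
    (forall t, continuous k' t) ->
    is_RInt (fun t => k' t * psi t + k t * dpsi t) a b 0).
  { intros k k' Hk Hk'.
    replace 0 with (minus (k b * psi b) (k a * psi a)).
    2: { rewrite Ha, Hb. unfold minus, plus, opp; simpl. ring. }
    apply (is_RInt_derive (fun t => k t * psi t)).
    - intros t _. specialize (Hk t). specialize (Hd t). solve_derive. ring.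
    - intros t _. apply (continuous_plus (V := R_NormedModule));
        apply (continuous_mult (K := R_AbsRing)); try easy.
      apply (ex_derive_continuous k). eexists; apply Hk. }
  (* [K1] and [K2] use the real and imaginary parts of e^(s t), whose t-derivatives are those of s
     e^(s t). *)
  assert (K1 := G (fun t => exp (x * t) * cos (y * t))
    (fun t => x * (exp (x * t) * cos (y * t)) + y * (- (exp (x * t) * sin (y * t))))).
  assert (K2 := G (fun t => - (exp (x * t) * sin (y * t)))
    (fun t => x * (- (exp (x * t) * sin (y * t))) - y * (exp (x * t) * cos (y * t)))).
  apply (RInt_correct (V := R_CompleteNormedModule)) in E1.
  apply (RInt_correct (V := R_CompleteNormedModule)) in E2.
  apply (RInt_correct (V := R_CompleteNormedModule)) in F1.
  apply (RInt_correct (V := R_CompleteNormedModule)) in F2.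
  unfold laplace. apply injective_projections; simpl.
  - apply Rplus_eq_reg_r with (RInt (fun t => exp (x * t) * cos (y * t) * dpsi t) a b).
    rewrite Rplus_opp_l.
    apply (is_RInt_unique _ _ _ 0) in K1.
    2: { intros t. auto_derive; trivial. ring. }
    2: { intros t. apply continuity_pt_filterlim. reg. }
    rewrite <- K1. symmetry. apply is_RInt_unique.
    match goal with |- is_RInt _ _ _ (x * ?p - - y * ?q + ?r) =>
      replace (x * p - - y * q + r) with (plus (plus (scal x p) (scal y q)) r)
        by (unfold plus, scal; simpl; unfold mult; simpl; ring) end.
    eapply is_RInt_ext; [|apply @is_RInt_plus;
      [apply @is_RInt_plus; apply @is_RInt_scal; eassumption|eassumption]].
    intros t _. unfold plus, scal; simpl; unfold mult; simpl; ring.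
  - apply Rplus_eq_reg_r with (RInt (fun t => - (exp (x * t) * sin (y * t)) * dpsi t) a b).
    rewrite Rplus_opp_l.
    apply (is_RInt_unique _ _ _ 0) in K2.
    2: { intros t. auto_derive; trivial. ring. }
    2: { intros t. apply continuity_pt_filterlim. reg. }
    rewrite <- K2. symmetry. apply is_RInt_unique.
    match goal with |- is_RInt _ _ _ (x * ?p + - y * ?q + ?r) =>
      replace (x * p + - y * q + r) with (plus (plus (scal x p) (scal (-y) q)) r)
        by (unfold plus, scal; simpl; unfold mult; simpl; ring) end.
    eapply is_RInt_ext; [|apply @is_RInt_plus;
      [apply @is_RInt_plus; apply @is_RInt_scal; eassumption|eassumption]].
    intros t _. unfold plus, scal; simpl; unfold mult; simpl; ring.
Qed.

(** * Shifting the contour *)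

(** D / -b is the integral of D e^(b x) over x > 0. Improper integrals are avoided: E + (D/b) e^(b
    x) is nondecreasing, and comparing 0 with a distant X, where E is small, gives the bound. *)
Lemma exp_decay_bound (E E' : R -> R) (b D M : R) :
  b < 0 -> 0 <= D -> 0 <= M ->
  (forall x, 0 < x -> is_derive E x (E' x) /\ Rabs (E' x) <= D * exp (b * x)) ->
  continuity_pt E 0 ->
  (forall x, 0 < x -> Rabs (E x) <= M * exp (b * x)) ->
  E 0 <= D / - b.
Proof.
  intros Hb HD HM HE Hc HE0. apply Rnot_lt_le. intros Hlt.
  assert (Hdelta : 0 < E 0 - D / - b) by lra.
  set (delta := E 0 - D / - b) in *.
  (* From e^(-b X) >= 1 - b X > (M + 1)/delta follows M e^(b X) < delta; the +1 keeps X positive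
     when M = 0. *)
  set (X := (M + 1) / (delta * - b)).
  assert (HX : 0 < X).
  { apply Rdiv_lt_0_compat; [lra|]. apply Rmult_lt_0_compat; lra. }
  assert (HeX : M * exp (b * X) < delta).
  { assert (H1 : 1 + - b * X <= exp (- b * X)) by apply exp_ineq1_le.
    assert (H2 : - b * X = (M + 1) / delta) by (unfold X; field; lra).
    replace (b * X) with (- (- b * X)) by ring. rewrite exp_Ropp.
    assert (H3 : (M + 1) / delta < exp (- b * X)) by lra.
    apply Rlt_div_l in H3; [|assumption].
    apply Rlt_div_l; [apply exp_pos|]. lra. }
  (* The mean value point may be the endpoint 0, where no derivative is known; the default 0 keeps
     [dg] non-negative there. *)
  set (dg := fun x => if Rle_dec x 0 then 0 else E' x + D * exp (b * x)).
  assert (Hdg : forall x, 0 <= dg x).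
  { intros x. unfold dg. destruct (Rle_dec x 0) as [_|Hx]; [lra|].
    destruct (HE x) as [_ H1]; [lra|]. apply Rabs_le_between in H1. lra. }
  destruct (MVT_gen (fun x => E x + D / b * exp (b * x)) 0 X dg) as (c & _ & Hc2).
  - rewrite Rmin_left, Rmax_right by lra. intros x Hx. destruct (HE x) as [H1 _]; [lra|].
    unfold dg. destruct (Rle_dec x 0) as [Hx'|_]; [lra|].
    solve_derive. field. lra.
  - rewrite Rmin_left, Rmax_right by lra. intros x Hx.
    apply continuity_pt_plus.
    + destruct (Req_dec x 0) as [->|Hx0]; [assumption|].
      apply continuity_pt_filterlim, (ex_derive_continuous E). eexists. apply HE. lra.
    + reg.
  - assert (H1 := Rmult_le_pos _ _ (Hdg c) (Rlt_le _ _ HX)).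
    assert (H2 := HE0 X HX). apply Rabs_le_between in H2.
    rewrite Rmult_0_r, exp_0, Rminus_0_r in Hc2.
    assert (H3 : 0 <= D / - b * exp (b * X)).
    { apply Rmult_le_pos; [|left; apply exp_pos].
      apply Rmult_le_pos; [assumption|]. left. apply Rinv_0_lt_compat. lra. }
    assert (H4 : D / b = - (D / - b)) by (field; lra).
    rewrite H4 in Hc2. unfold delta in *. lra.
Qed.

Lemma continuity_2d_pt_snd (f : R -> R -> R) (x y : R) :
  continuity_2d_pt f x y -> continuous (f x) y.
Proof.
  intros H. apply continuity_pt_filterlim. intros eps He.
  destruct (H (mkposreal eps He)) as [d Hd].
  exists d. split; [apply cond_pos|]. intros s [_ Hs]. apply Hd; [|exact Hs].
  rewrite Rminus_diag, Rabs_R0. apply cond_pos.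
Qed.

Lemma continuity_RInt_param (f : R -> R -> R) (a b x : R) :
  a <= b -> (forall u v, continuity_2d_pt f u v) ->
  continuity_pt (fun x => RInt (f x) a b) x.
Proof.
  intros Hab Hf.
  assert (Hex : forall u, ex_RInt (f u) a b).
  { intros u.
    apply (ex_RInt_continuous (V := R_CompleteNormedModule)). intros t _.
    now apply continuity_2d_pt_snd. }
  intros eps He.
  assert (He' : 0 < eps / (2 * (b - a + 1))) by (apply Rdiv_lt_0_compat; lra).
  destruct (uniform_continuity_2d_1d' f a b x (fun t _ => Hf x t) (mkposreal _ He'))
    as [d Hd].
  exists d. split; [apply cond_pos|]. intros y [_ Hy]. simpl in *. unfold R_dist in *.
  assert (E : RInt (f y) a b - RInt (f x) a b = RInt (fun t => f y t - f x t) a b)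
    by (symmetry; apply (RInt_minus (V := R_CompleteNormedModule)); apply Hex).
  rewrite E.
  apply Rle_lt_trans with ((b - a) * (eps / (2 * (b - a + 1)))).
  - apply abs_RInt_le_const; [assumption| |].
    + apply (ex_RInt_minus (V := R_NormedModule)); apply Hex.
    + intros t Ht. left. apply Rabs_def2 in Hy.
      apply Hd; try lra. rewrite Rminus_diag, Rabs_R0. apply cond_pos.
  - set (e := eps / (2 * (b - a + 1))) in *.
    replace eps with (2 * (b - a + 1) * e) by (unfold e; field; lra). nra.
Qed.

(* [u' = d_x u = d_y w] is one of the two Cauchy-Riemann equations. *)
Lemma contour_shift_bound (u w u' : R -> R -> R) (b M N A B : R) :
  b < 0 -> 0 <= M -> 0 <= N -> A < 0 -> 0 < B ->
  (forall x y, 0 < x -> is_derive (fun x => u x y) x (u' x y) /\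
     is_derive (w x) y (u' x y) /\ continuity_2d_pt u' x y) ->
  (forall x y, continuity_2d_pt (fun x y => u (Rmax x 0) y) x y) ->
  (forall x y, 0 < x -> Rabs (u x y) <= M * exp (b * x)) ->
  (forall x y, 0 < x -> y <> 0 -> Rabs (w x y) <= N * exp (b * x) / Rabs y) ->
  Rabs (RInt (u 0) A B) <= N * (/ - A + / B) / - b.
Proof.
  intros Hb HM HN HA HB Hd Hc Hu Hw.
  (* Clamping leaves x >= 0 unchanged and makes [E] continuous on both sides of 0, although nothing
     is assumed of u for x < 0. *)
  set (E := fun x => RInt (fun y => u (Rmax x 0) y) A B).
  assert (Hex : forall x, ex_RInt (fun y => u (Rmax x 0) y) A B).
  { intros x. apply (ex_RInt_continuous (V := R_CompleteNormedModule)). intros t _.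
    apply (continuity_2d_pt_snd (fun x y => u (Rmax x 0) y)), Hc. }
  assert (HE0 : RInt (u 0) A B = E 0).
  { apply RInt_ext_R. intros t. now rewrite Rmax_left by lra. }
  assert (HEc : continuity_pt E 0) by (apply continuity_RInt_param; [lra|exact Hc]).
  assert (HD : 0 <= N * (/ - A + / B)).
  { apply Rmult_le_pos; [assumption|].
    assert (0 < / - A) by (apply Rinv_0_lt_compat; lra).
    assert (0 < / B) by (apply Rinv_0_lt_compat; lra). lra. }
  assert (HEd : forall x, 0 < x -> is_derive E x (w x B - w x A)).
  { intros x Hx.
    assert (Hloc : forall z t, 0 < z -> is_derive (fun x => u (Rmax x 0) t) z (u' z t)).
    { intros z t Hz. apply is_derive_ext_loc with (fun x => u x t).
      - apply (locally_interval _ z 0 p_infty); [exact Hz|easy|].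
        intros y Hy _. change (0 < y) in Hy. rewrite Rmax_left; [reflexivity|now left].
      - now apply Hd. }
    (* After differentiation under the integral, the integrand u' is also the y-derivative of w, so
       the fundamental theorem leaves only the two sides. *)
    replace (w x B - w x A) with (RInt (fun t => Derive (fun x => u (Rmax x 0) t) x) A B).
    - apply (is_derive_RInt_param (fun x y => u (Rmax x 0) y)).
      + apply (locally_interval _ x 0 p_infty); [exact Hx|easy|].
        intros z Hz _ t _. eexists. now apply Hloc.
      + intros t _. apply continuity_2d_pt_ext_loc with u'; [|now apply Hd].
        exists (mkposreal x Hx). intros z v Hz _. simpl in Hz. apply Rabs_def2 in Hz.
        symmetry. apply is_derive_unique, Hloc. lra.
      + apply filter_forall. exact Hex.
    - transitivity (RInt (u' x) A B).
      + apply RInt_ext_R. intros t. now apply is_derive_unique, Hloc.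
      + apply is_RInt_unique.
        apply (is_RInt_derive (V := R_CompleteNormedModule) (w x) (u' x)).
        * intros t _. now apply Hd.
        * intros t _. now apply continuity_2d_pt_snd, Hd. }
  assert (HEd' : forall x, 0 < x -> Rabs (w x B - w x A) <= N * (/ - A + / B) * exp (b * x)).
  { intros x Hx. unfold Rminus. eapply Rle_trans; [apply Rabs_triang|]. rewrite Rabs_Ropp.
    assert (H1 := Hw x B Hx). assert (H2 := Hw x A Hx).
    rewrite (Rabs_pos_eq B) in H1 by lra. rewrite (Rabs_left A) in H2 by lra.
    unfold Rdiv in *. specialize (H1 ltac:(lra)). specialize (H2 ltac:(lra)). lra. }
  assert (HEb : forall x, 0 < x -> Rabs (E x) <= (B - A) * M * exp (b * x)).
  { intros x Hx. rewrite Rmult_assoc. apply abs_RInt_le_const; [lra|apply Hex|].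
    intros t _. rewrite Rmax_left by lra. now apply Hu. }
  (* [exp_decay_bound] is one-sided, so it is applied to both -E and E. *)
  rewrite HE0. apply Rabs_le. split.
  - apply Ropp_le_cancel. rewrite Ropp_involutive.
    apply (exp_decay_bound (fun x => - E x) (fun x => - (w x B - w x A)) b _ ((B - A) * M));
      try assumption.
    + apply Rmult_le_pos; lra.
    + intros x Hx. split; [apply (is_derive_opp (V := R_NormedModule) E), HEd, Hx|].
      rewrite Rabs_Ropp. now apply HEd'.
    + now apply continuity_pt_opp.
    + intros x Hx. rewrite Rabs_Ropp. now apply HEb.
  - apply (exp_decay_bound E (fun x => w x B - w x A) b _ ((B - A) * M)); try assumption.
    + apply Rmult_le_pos; lra.
    + intros x Hx. split; [now apply HEd|now apply HEd'].
Qed.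

Lemma im_le_Cmod (w : C) : Rabs (Im w) <= Cmod w.
Proof. apply Rle_trans with (2 := Rmax_Cmod _). apply Rmax_r. Qed.

Lemma Cmod_le_Rabs (w : C) : Cmod w <= Rabs (Re w) + Rabs (Im w).
Proof.
  replace w with (RtoC (Re w) + Ci * RtoC (Im w))%C at 1
    by (apply injective_projections; unfold Re, Im; simpl; ring).
  eapply Rle_trans; [apply Cmod_triangle|].
  rewrite Cmod_mult, Cmod_Ci, !Cmod_R. lra.
Qed.

(** Since max(x, 0) is 1-Lipschitz in x, the same radius works. *)
Lemma ccont_Rmax (f : R -> R -> C) (x y : R) :
  ccont f (Rmax x 0) y -> ccont (fun x y => f (Rmax x 0) y) x y.
Proof.
  assert (Hmax : forall z, Rabs (Rmax z 0 - Rmax x 0) <= Rabs (z - x)).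
  { intros z. unfold Rmax. destruct (Rle_dec z 0), (Rle_dec x 0);
      unfold Rabs; repeat destruct Rcase_abs; lra. }
  intros [H1 H2]. split; intros eps.
  - destruct (H1 eps) as [d Hd]. exists d. intros u v Hu Hv.
    apply Hd; [|assumption]. eapply Rle_lt_trans; [apply Hmax|assumption].
  - destruct (H2 eps) as [d Hd]. exists d. intros u v Hu Hv.
    apply Hd; [|assumption]. eapply Rle_lt_trans; [apply Hmax|assumption].
Qed.

(** * The damped transform and its integral over the imaginary axis *)

Section Damped.

Variables (tau beta kappa : R) (psi dpsi : R -> R) (a b : R).
Hypothesis (Htau : 0 < tau) (Hbeta0 : 0 < beta) (Hbeta1 : beta <= 1) (Hkappa : 0 <= kappa).
Hypothesis (Hd : forall t, is_derive psi t (dpsi t)) (Hdc : forall t, continuous dpsi t).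
Hypothesis (Ha : psi a = 0) (Hb : psi b = 0) (Hab : a <= b) (Hb0 : b < 0).

Definition damped (x y : R) : C :=
  (Cexp (RtoC (- kappa) * attenuation tau beta x y) * laplace psi a b x y)%C.

Lemma psi_continuous : forall t, continuous psi t.
Proof. intros t. apply (ex_derive_continuous psi). eexists; apply Hd. Qed.

Lemma damped_holomorphic : exists F', holomorphic punctured_halfplane damped F'.
Proof.
  destruct (attenuation_holomorphic tau beta) as [h' Hh']; try assumption.
  eexists. apply holomorphic_mult.
  - apply holomorphic_Cexp, holomorphic_mult; [apply holomorphic_const|exact Hh'].
  - intros x y [Hx _]. now apply (holomorphic_laplace psi a b psi_continuous Hab Hb0).
Qed.

(* At the branch point s = 0 continuity comes from |attenuation| <= |s|. *)
Lemma damped_continuous (x y : R) : ccont (fun x y => damped (Rmax x 0) y) x y.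
Proof.
  assert (Hm : 0 <= Rmax x 0) by apply Rmax_r.
  apply ccont_mult.
  2: { apply (ccont_Rmax (laplace psi a b)), ccont_laplace; try assumption.
       exact psi_continuous. }
  apply ccont_Cexp, ccont_mult; [apply ccont_const|].
  destruct (Ceq_dec (svar (Rmax x 0) y) 0) as [Hs|Hs].
  - assert (Hz : attenuation tau beta (Rmax x 0) y = 0%C)
      by (unfold attenuation; rewrite Hs; ring).
    assert (Hc : continuity_2d_pt (fun x y => Cmod (svar (Rmax x 0) y)) x y)
      by apply continuity_2d_pt_Cmod, ccont_Rmax, ccont_svar.
    assert (Hle : forall u v, Cmod (attenuation tau beta (Rmax u 0) v)
                  <= Rabs (Cmod (svar (Rmax u 0) v) - Cmod (svar (Rmax x 0) y))).
    { intros u v. rewrite Hs, Cmod_0, Rminus_0_r.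
      eapply Rle_trans; [|apply Rle_abs].
      apply Cmod_attenuation_le; try assumption. apply Rmax_r. }
    split; intros eps; destruct (Hc eps) as [d H]; exists d; intros u v Hu Hv;
      specialize (H u v Hu Hv); rewrite Hz; eapply Rle_lt_trans; [|exact H| |exact H];
      (eapply Rle_trans; [|apply Hle]).
    + change (Re 0%C) with 0. rewrite Rminus_0_r. apply re_le_Cmod.
    + change (Im 0%C) with 0. rewrite Rminus_0_r. apply im_le_Cmod.
  - destruct (attenuation_holomorphic tau beta) as [h' Hh']; try assumption.
    apply ccont_Rmax. now apply (Hh' (Rmax x 0) y).
Qed.

Lemma Cmod_damped_le (x y : R) : 0 <= x -> Cmod (damped x y) <= Cmod (laplace psi a b x y).
Proof.
  intros Hx. unfold damped. rewrite Cmod_mult, Cexp_Cmod.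
  assert (Hr := Re_attenuation_ge_0 tau beta Htau Hbeta0 Hbeta1 x y Hx).
  replace (Re (RtoC (- kappa) * attenuation tau beta x y)%C)
    with (- kappa * Re (attenuation tau beta x y)) by (unfold Re; simpl; ring).
  rewrite <- (Rmult_1_l (Cmod (laplace psi a b x y))) at 2.
  apply Rmult_le_compat_r; [apply Cmod_ge_0|].
  assert (He : - kappa * Re (attenuation tau beta x y) <= 0) by nra.
  apply Rle_trans with (exp 0); [|rewrite exp_0; apply Rle_refl].
  destruct He as [He| ->]; [left; now apply exp_increasing|lra].
Qed.

(** For x >= 0 and t <= b one has e^(x t) <= e^(b x); the constant contains a 2 because real and
    imaginary parts are bounded separately. *)
Lemma Cmod_laplace_le (chi : R -> R) :
  (forall t, continuous chi t) ->
  exists M, 0 <= M /\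
    forall x y, 0 <= x -> Cmod (laplace chi a b x y) <= M * exp (b * x).
Proof.
  intros Hchi. destruct (continuous_bounded_segment chi a b Hchi Hab) as (M & HM0 & HM).
  exists (2 * ((b - a) * M)). split; [nra|]. intros x y Hx.
  destruct (laplace_bound chi a b Hchi x y (exp (b * x) * M)) as [H1 H2]; [assumption| |].
  - intros t Ht. apply Rmult_le_compat; [left; apply exp_pos|apply Rabs_pos| |now apply HM].
    assert (Hxt : x * t <= b * x) by nra.
    destruct Hxt as [Hxt| ->]; [left; now apply exp_increasing|lra].
  - eapply Rle_trans; [apply Cmod_le_Rabs|]. lra.
Qed.

(** The bound M from [psi] makes the far line vanish. The sides are governed by N from [dpsi]: |s|
    times the transform of [psi] is at most N e^(b x), and |s| >= |y|. Integrating e^(b x) gives the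
    constant N / -b. *)
Lemma damped_RInt_bound :
  exists K, 0 <= K /\ forall A B, A < 0 -> 0 < B ->
    Rabs (RInt (fun y => Re (damped 0 y)) A B) <= K * (/ - A + / B) /\
    Rabs (RInt (fun y => Im (damped 0 y)) A B) <= K * (/ - A + / B).
Proof.
  destruct damped_holomorphic as [F' HF'].
  destruct (Cmod_laplace_le psi psi_continuous) as (M & HM0 & HM).
  destruct (Cmod_laplace_le dpsi Hdc) as (N & HN0 & HN).
  assert (HF : forall x y, 0 < x -> Cmod (damped x y) <= M * exp (b * x)).
  { intros x y Hx. eapply Rle_trans; [apply Cmod_damped_le; lra|]. apply HM; lra. }
  assert (HG : forall x y, 0 < x -> y <> 0 ->
            Cmod (damped x y) <= N * exp (b * x) / Rabs y).
  { intros x y Hx Hy. eapply Rle_trans; [apply Cmod_damped_le; lra|].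
    apply Rle_div_r; [now apply Rabs_pos_lt|].
    eapply Rle_trans; [|apply (HN x y); lra].
    rewrite <- (Cmod_opp (laplace dpsi a b x y)).
    rewrite <- (laplace_derive psi dpsi a b x y Hd Hdc Ha Hb), Cmod_mult, Rmult_comm.
    apply Rmult_le_compat_r; [apply Cmod_ge_0|].
    eapply Rle_trans; [|apply Rmax_Cmod]. simpl. rewrite Rabs_Ropp. apply Rmax_r. }
  assert (HD : forall x y, 0 < x -> punctured_halfplane x y).
  { intros x y Hx. split; [lra|]. intros E. apply (f_equal fst) in E. simpl in E. lra. }
  exists (N / - b). split.
  { apply Rmult_le_pos; [assumption|]. left. apply Rinv_0_lt_compat. lra. }
  intros A B HA HB.
  replace (N / - b * (/ - A + / B)) with (N * (/ - A + / B) / - b)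
    by (unfold Rdiv; ring).
  split.
  (* As the y-derivative of F is -i F', the partner of Re F is -Im F, and that of Im F is Re F. *)
  - apply (contour_shift_bound (fun x y => Re (damped x y)) (fun x y => - Im (damped x y))
      (fun x y => Re (F' x y)) b M N A B); try assumption.
    + intros x y Hx. destruct (HF' x y (HD x y Hx)) as ([P1 P2] & [Q1 Q2] & _ & [C1 C2]).
      split; [exact P1|]. split; [|exact C1].
      rewrite Im_mult_opp_Ci in Q2.
      rewrite <- (Ropp_involutive (Re (F' x y))).
      exact (is_derive_opp (V := R_NormedModule) _ _ _ Q2).
    + intros x y. apply (damped_continuous x y).
    + intros x y Hx. eapply Rle_trans; [apply re_le_Cmod|now apply HF].
    + intros x y Hx Hy. rewrite Rabs_Ropp.
      eapply Rle_trans; [apply im_le_Cmod|now apply HG].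
  - apply (contour_shift_bound (fun x y => Im (damped x y)) (fun x y => Re (damped x y))
      (fun x y => Im (F' x y)) b M N A B); try assumption.
    + intros x y Hx. destruct (HF' x y (HD x y Hx)) as ([P1 P2] & [Q1 Q2] & _ & [C1 C2]).
      split; [exact P2|]. split; [|exact C2].
      now rewrite Re_mult_opp_Ci in Q1.
    + intros x y. apply (damped_continuous x y).
    + intros x y Hx. eapply Rle_trans; [apply im_le_Cmod|now apply HF].
    + intros x y Hx Hy. eapply Rle_trans; [apply re_le_Cmod|now apply HG].
Qed.

Lemma is_RInt_damped (A B : R) :
  is_RInt (V := C_R_NormedModule) (damped 0) A B
    (RInt (fun y => Re (damped 0 y)) A B, RInt (fun y => Im (damped 0 y)) A B).
Proof.
  assert (Hm : Rmax 0 0 = 0) by (apply Rmax_left; lra).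
  apply (is_RInt_fct_extend_pair (U := R_NormedModule) (V := R_NormedModule));
    apply (RInt_correct (V := R_CompleteNormedModule)),
      (ex_RInt_continuous (V := R_CompleteNormedModule)); intros y _.
  - assert (H := continuity_2d_pt_snd _ _ _ (proj1 (damped_continuous 0 y))).
    simpl in H. now rewrite Hm in H.
  - assert (H := continuity_2d_pt_snd _ _ _ (proj2 (damped_continuous 0 y))).
    simpl in H. now rewrite Hm in H.
Qed.

Lemma is_RInt_gen_damped :
  is_RInt_gen (V := C_R_NormedModule) (damped 0)
    (Rbar_locally m_infty) (Rbar_locally p_infty) (RtoC 0).
Proof.
  destruct damped_RInt_bound as (K & HK & HB).
  intros P [eps HP].
  (* Beyond X, K (1/|A| + 1/B) <= 2 K/X < eps. The ends A and B vary independently, so this is more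
     than a principal value. *)
  set (X := (2 * K + 1) / eps).
  assert (He := cond_pos eps).
  assert (HX : 0 < X) by (apply Rdiv_lt_0_compat; lra).
  exists (fun A => A < - X) (fun B => X < B).
  - now exists (- X).
  - now exists X.
  - intros A B HA HB'. simpl. eexists. split; [apply is_RInt_damped|].
    assert (HA0 : A < 0) by lra. assert (HB0 : 0 < B) by lra.
    destruct (HB A B HA0 HB0) as [H1 H2].
    assert (Hlt : K * (/ - A + / B) < eps).
    { assert (/ - A <= / X) by (apply Rinv_le_contravar; lra).
      assert (/ B <= / X) by (apply Rinv_le_contravar; lra).
      assert (HXi : / X * (2 * K + 1) = eps) by (unfold X; field; lra).
      assert (0 < / X) by now apply Rinv_0_lt_compat.
      nra. }
    apply HP. split; simpl; unfold ball; simpl; unfold AbsRing_ball, abs, minus, plus, opp; simpl;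
      rewrite Ropp_0, Rplus_0_r; eapply Rle_lt_trans; eassumption.
Qed.

End Damped.

(** * The symbol and the test functions on the imaginary axis *)

Lemma Khat_attenuation (c0 alpha0 tau gamma r omega : R) :
  0 < c0 -> 0 < tau -> 1 < gamma -> gamma <= 2 ->
  Khat c0 alpha0 tau gamma r omega =
  Cexp (RtoC (- (alpha0 * r / c0)) * attenuation tau (gamma - 1) 0 omega)%C.
Proof.
  intros Hc Ht Hg1 Hg2. unfold Khat. f_equal. unfold alpha_ksb, attenuation.
  change ((0, - omega) : C) with (svar 0 omega).
  (* At omega = 0 [Cpow] returns 0 and [relaxation] does not, but the factor s makes both exponents
     0. *)
  destruct (Ceq_dec (svar 0 omega) 0) as [->|Hs]; [unfold Cdiv; ring|].
  assert (HD : punctured_halfplane 0 omega) by (split; [lra|assumption]).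
  assert (E : ((0, - (tau * omega)) : C) = (RtoC tau * svar 0 omega)%C)
    by (apply injective_projections; simpl; ring).
  rewrite E, Cpow_Cln by now apply slit_scaled_svar.
  change (Cexp (RtoC (gamma - 1) * Cln (RtoC tau * svar 0 omega))%C)
    with (relaxation tau (gamma - 1) 0 omega).
  unfold Csqrt. rewrite Cpow_Cln by (apply slit_one_plus_relaxation; lra || assumption).
  replace (RtoC (- (1 / 2)) * Cln (1 + relaxation tau (gamma - 1) 0 omega))%C
    with (- (RtoC (1 / 2) * Cln (1 + relaxation tau (gamma - 1) 0 omega)))%C
    by (rewrite RtoC_opp; ring).
  rewrite Cexp_opp.
  set (q := Cexp (RtoC (1 / 2) * Cln (1 + relaxation tau (gamma - 1) 0 omega))%C).
  assert (Hq : q <> 0%C) by apply Cexp_neq_0.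
  assert (Hc' : RtoC c0 <> 0%C).
  { intros F. apply (f_equal fst) in F. simpl in F. lra. }
  rewrite RtoC_opp, RtoC_div, RtoC_mult by lra. field. now split.
Qed.

Lemma Finv_test_laplace (phi : R -> R) (a b omega : R) :
  (forall t, continuous phi t) ->
  Finv_test phi a b omega = (RtoC (/ sqrt (2 * PI)) * laplace phi a b 0 omega)%C.
Proof.
  intros Hphi. unfold Finv_test. f_equal.
  apply (is_RInt_unique (V := C_R_CompleteNormedModule)).
  destruct (ex_RInt_laplace phi a b Hphi 0 omega) as [E1 E2].
  apply (RInt_correct (V := R_CompleteNormedModule)) in E1.
  apply (RInt_correct (V := R_CompleteNormedModule)) in E2.
  apply (is_RInt_fct_extend_pair (U := R_NormedModule) (V := R_NormedModule)).
  - eapply is_RInt_ext; [|exact E1]. intros t _. simpl.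
    rewrite Rmult_0_l, exp_0, cos_neg. ring.
  - eapply is_RInt_ext; [|exact E2]. intros t _. simpl.
    rewrite Rmult_0_l, exp_0, sin_neg. ring.
Qed.

(** * Causality *)

(** The support condition speaks only of points strictly outside [a, b]; the endpoint values
    required by the integration by parts follow by continuity. *)
Lemma continuous_limit_of_zeros (f : R -> R) (a : R) :
  continuous f a ->
  (forall d, 0 < d -> exists t, Rabs (t - a) < d /\ f t = 0) -> f a = 0.
Proof.
  intros Hf Hz. destruct (Req_dec (f a) 0) as [H|H]; [assumption|exfalso].
  apply continuity_pt_filterlim in Hf.
  destruct (Hf (Rabs (f a)) (Rabs_pos_lt _ H)) as (d & Hd & Hc).
  destruct (Hz d Hd) as (t & Ht & Hft).
  destruct (Req_dec a t) as [<-|Hat]; [easy|].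
  assert (Hlt : Rabs (f t - f a) < Rabs (f a)).
  { apply Hc. split; [now split|exact Ht]. }
  rewrite Hft, Rminus_0_l, Rabs_Ropp in Hlt. lra.
Qed.

Lemma laplace_zero (psi : R -> R) (a b x y : R) :
  (forall t, psi t = 0) -> laplace psi a b x y = 0%C.
Proof.
  intros H. apply injective_projections; simpl;
    (transitivity (RInt (fun _ => 0) a b);
     [apply RInt_ext_R; intros t; rewrite H; ring
     |rewrite RInt_const; apply Rmult_0_r]).
Qed.

(* K(x,.) = 1/sqrt(2pi) F^{-1}{Khat} is a tempered distribution; causality means
   that it vanishes on the open set (-oo,0): <K(x,.), phi> = 0 for every test
   function phi with compact support in (-oo,0).  By definition of the
   distributional inverse transform (Khat is bounded and continuous),
   <K(x,.), phi> = 1/sqrt(2pi) int_R Khat(omega) (F^{-1} phi)(omega) d omega. *)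
Theorem theorem7 (c0 alpha0 tau0 gamma : R)
  (Hc0 : 0 < c0) (Ha0 : 0 < alpha0) (Ht0 : 0 < tau0)
  (Hg1 : 1 < gamma) (Hg2 : gamma <= 2) :
  forall (x1 x2 x3 : R) (phi : R -> R) (a b : R),
    smooth phi -> b < 0 ->
    (forall t, (t < a \/ b < t) -> phi t = 0) ->
    is_RInt_gen (V := C_R_NormedModule)
      (fun omega =>
         (RtoC (/ sqrt (2 * PI)) * Khat c0 alpha0 tau0 gamma (norm3 x1 x2 x3) omega
          * Finv_test phi a b omega)%C)
      (Rbar_locally m_infty) (Rbar_locally p_infty) (RtoC 0).
Proof.
  intros x1 x2 x3 phi a b Hphi Hb Hsupp.
  set (c := / sqrt (2 * PI)). set (r := norm3 x1 x2 x3).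
  assert (Hd : forall t, is_derive phi t (Derive phi t))
    by (intros t; exact (Derive_correct _ _ (Hphi 1%nat t))).
  assert (Hdc : forall t, continuous (Derive phi) t).
  { intros t. apply (ex_derive_continuous (Derive phi)). exact (Hphi 2%nat t). }
  assert (Hc : forall t, continuous phi t).
  { intros t. apply (ex_derive_continuous phi). exact (Hphi 1%nat t). }
  assert (Hphib : phi b = 0).
  { apply continuous_limit_of_zeros; [apply Hc|]. intros d Hd0. exists (b + d / 2).
    split; [rewrite Rabs_pos_eq; lra|]. apply Hsupp. right. lra. }
  assert (Ha' : exists a', a' <= b /\ phi a' = 0 /\
    forall omega, laplace phi a' b 0 omega = laplace phi a b 0 omega).
  { destruct (Rle_lt_dec a b) as [Hab|Hab].
    - exists a. split; [assumption|]. split; [|easy].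
      apply continuous_limit_of_zeros; [apply Hc|]. intros d Hd0. exists (a - d / 2).
      split; [rewrite Rabs_left; lra|]. apply Hsupp. left. lra.
    (* If b < a, every t satisfies t < a or b < t, so phi vanishes identically and the degenerate
       interval [b, b] serves as well. *)
    - exists b. split; [apply Rle_refl|]. split; [assumption|].
      assert (H0 : forall t, phi t = 0) by (intros t; apply Hsupp; lra).
      intros omega. now rewrite !laplace_zero. }
  destruct Ha' as (a' & Hab & Hphia & Hlap).
  assert (Hr : 0 <= alpha0 * r / c0).
  { apply Rmult_le_pos; [|left; now apply Rinv_0_lt_compat].
    apply Rmult_le_pos; [lra|apply sqrt_pos]. }
  assert (HK := is_RInt_gen_damped tau0 (gamma - 1) (alpha0 * r / c0) phi (Derive phi) a' b
    Ht0 ltac:(lra) ltac:(lra) Hr Hd Hdc Hphia Hphib Hab Hb).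
  (* One factor c comes from the definition of K, the other from [Finv_test]. *)
  apply (is_RInt_gen_scal (V := C_R_NormedModule) _ (c * c)) in HK.
  replace (RtoC 0) with (scal (V := C_R_NormedModule) (c * c) (RtoC 0))
    by (apply injective_projections; apply Rmult_0_r).
  revert HK. apply is_RInt_gen_ext. apply filter_forall. intros AB omega _.
  rewrite Khat_attenuation, Finv_test_laplace, <- Hlap by assumption.
  fold c r. unfold damped.
  set (u := Cexp _). set (v := laplace _ _ _ _ _).
  apply injective_projections; unfold scal; simpl; unfold scal; simpl; unfold mult; simpl; ring.
Qed.
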